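(* Let $E$ be a separable Banach space. Then for every $f \in B_{E^*}$ there is a sequence $(f_n)_{n\ge1}$ of extreme points of $B_{E^*}$ such that $\frac{f_1 + \dots + f_N}{N} \to f$ in the weak$^*$ topology of $E^*$ as $N \to \infty$.
   Context: Banach spaces are real. $B_{E^*}$ is the closed unit ball of the dual $E^*$. *)

(* Defs.v *)
From HB Require Import structures.
From mathcomp Require Import all_boot all_order all_algebra.
From mathcomp Require Import all_classical all_reals all_analysis.

Set Implicit Arguments.
Unset Strict Implicit.
Unset Printing Implicit Defensive.

Import Order.TTheory GRing.Theory Num.Theory.
Import numFieldNormedType.Exports.

Local Open Scope classical_set_scope.
Local Open Scope ring_scope.

Definition separable (T : topologicalType) : Prop :=
  exists2 D : set T, countable D & dense D.

Definition extreme_point (R : realType) (V : lmodType R) (A : set V) (x : V)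
    : Prop :=
  A x /\ forall (y z : V) (t : R), A y -> A z -> 0 < t -> t < 1 ->
    x = t *: y + (1 - t) *: z -> y = x /\ z = x.

Section ContinuousDual.
Variables (R : realType) (E : normedModType R).

Definition continuous_linear_form : {pred E -> R^o} :=
  mem [set f : E -> R^o | linear f /\ continuous f].

Record dual := Dual {
  dual_fun :> E -> R^o ;
  dual_funP : dual_fun \in continuous_linear_form }.

HB.instance Definition _ := [isSub for dual_fun].
HB.instance Definition _ := [Choice of dual by <:].

Fact continuous_linear_form_submod : submod_closed continuous_linear_form.
Proof.
split.
  apply/mem_set; split; last by move=> x; exact: cvg_cst.
  by move=> a x y /=; rewrite scaler0 addr0.
move=> a f g /set_mem[lf cf] /set_mem[lg cg]; apply/mem_set; split.
  move=> b x y /=.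
  rewrite !fctE lf lg !scalerDr !scalerA (mulrC b a) addrACA.
  by [].
by move=> x; apply: cvgD; [apply: cvgZr; exact: cf|exact: cg].
Qed.

HB.instance Definition _ := GRing.isSubmodClosed.Build R (E -> R^o)
  continuous_linear_form continuous_linear_form_submod.
HB.instance Definition _ := [SubChoice_isSubLmodule of dual by <:].

Lemma dual_linear (f : dual) : linear f.
Proof. by have /set_mem[] := dual_funP f. Qed.

Lemma dual_continuous (f : dual) : continuous f.
Proof. by have /set_mem[] := dual_funP f. Qed.

HB.instance Definition _ (f : dual) :=
  GRing.isLinear.Build R E R^o *:%R f (dual_linear f).

Definition dual_norm (f : dual) : R :=
  sup [set `|f x| | x in [set x : E | `|x| <= 1]].

Fact dual_norm_has_sup (f : dual) :
  has_sup [set `|f x| | x in [set x : E | `|x| <= 1]].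
Proof.
split; first by exists `|f 0|, 0 => //=; rewrite normr0.
have /linear_boundedP : bounded_near f (nbhs (0 : E)).
  exact/linear_bounded_continuous/dual_continuous.
move=> /pinfty_ex_gt0[r r0 fr]; exists r => _ [x /= x1 <-].
by rewrite (le_trans (fr x))// ler_piMr// ltW.
Qed.

Lemma dual_norm_ge (f : dual) (x : E) : `|x| <= 1 -> `|f x| <= dual_norm f.
Proof. by move=> x1; apply: sup_upper_bound (dual_norm_has_sup f) _ _; exists x. Qed.

Lemma dual_norm_le (f : dual) (r : R) :
  (forall x, `|x| <= 1 -> `|f x| <= r) -> dual_norm f <= r.
Proof.
move=> fr; apply: ge_sup; first by case: (dual_norm_has_sup f).
by move=> _ [x /= x1 <-]; exact: fr.
Qed.

Lemma ler_dual_norm (f : dual) (x : E) : `|f x| <= dual_norm f * `|x|.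
Proof.
have [->|x0] := eqVneq x 0; first by rewrite linear0 !normr0 mulr0.
rewrite -ler_pdivrMr ?normr_gt0// mulrC -[X in X * _]ger0_norm ?invr_ge0//.
rewrite -normrM; have -> : `|x|^-1 * f x = f (`|x|^-1 *: x) by rewrite linearZ.
by apply: dual_norm_ge; rewrite normrZ normfV normr_id mulVf ?normr_eq0.
Qed.

Fact dual_norm_triangle (f g : dual) :
  dual_norm (f + g) <= dual_norm f + dual_norm g.
Proof.
apply: dual_norm_le => x x1; apply: le_trans (ler_normD _ _) _.
by apply: lerD; exact: dual_norm_ge.
Qed.

Fact dual_normZ (a : R) (f : dual) : dual_norm (a *: f) = `|a| * dual_norm f.
Proof.
have le_normZ b g : dual_norm (b *: g) <= `|b| * dual_norm g.
  apply: dual_norm_le => x x1; rewrite normrM.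
  by apply: ler_wpM2l => //; exact: dual_norm_ge.
apply/eqP; rewrite eq_le le_normZ /=.
have [->|a0] := eqVneq a 0.
  rewrite normr0 mul0r; apply: le_trans (normr_ge0 _) (@dual_norm_ge _ 0 _).
  by rewrite normr0.
rewrite -ler_pdivlMl ?normr_gt0// -normfV.
by apply: le_trans (le_normZ _ _); rewrite scalerA mulVf// scale1r.
Qed.

Fact dual_norm_eq0 (f : dual) : dual_norm f = 0 -> f = 0.
Proof.
move=> f0; apply/val_inj/funext => x; apply/eqP.
by rewrite -normr_le0 (le_trans (ler_dual_norm f x))// f0 mul0r.
Qed.

HB.instance Definition _ := Lmodule_isNormed.Build R dual
  dual_norm_triangle dual_normZ dual_norm_eq0.

Definition dual_unit_ball : set dual := [set f | `|f| <= 1].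

(* The topology of [dual] itself is the one of the operator norm; [weak_star]
   is the same type with the coarsest topology that makes all evaluations
   f |-> f x continuous. *)
Definition weak_star : Type :=
  initial_topology (fun f : dual => (f : {ptws E -> R^o})).

HB.instance Definition _ := Topological.on weak_star.

End ContinuousDual.

Arguments dual_unit_ball {R} E _.

Lemma weak_star_cvgP (R : realType) (E : normedModType R)
    (F : set_system (weak_star E)) (f : weak_star E) : Filter F ->
  F --> f <-> forall x : E, (g : dual E) x @[g --> F] --> (f : dual E) x.
Proof.
move=> FF; pose ev (g : weak_star E) : {ptws E -> R^o} := dual_fun g.
suff -> : (F --> f) <-> {ptws, ev @ F --> (ev f : E -> R^o)}.
  exact: pointwise_cvgP.
split=> [Ff A /= evfA|Ff A].
  by apply: Ff; exact: (@initial_continuous _ _ ev f).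
rewrite nbhsE => -[B [[C oC <-] Cf] BA].
by apply: filterS BA _; apply: (Ff C); exact: open_nbhs_nbhs.
Qed.

(* Main.v *)
Require Import Defs.
From mathcomp Require Import all_boot all_order all_algebra.
From mathcomp Require Import all_classical all_reals all_analysis.
From mathcomp Require Import lra ring.
Import Order.TTheory GRing.Theory Num.Theory.
Import numFieldNormedType.Exports.
Local Open Scope classical_set_scope.
Local Open Scope ring_scope.

(** Write B for the unit ball of the dual of E.  The argument has two parts.

    First, every y in E is normed by an extreme point of B: some extreme e has
    e y = |y|.  The weak* compactness behind the Krein-Milman theorem is
    avoided by working with gauges, the sublinear functionals p bounded by the
    norm; p stands for the set of linear forms g <= p, whose support function
    it is.  Passing from p to the face where g d takes its largest value p d
    replaces p by the explicit infimum [face_gauge p d].  Starting from the norm,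
    which stands for B, and doing this along a dense sequence d_0, d_1, ...
    yields a decreasing sequence of gauges.  Its limit is odd on each d_k,
    hence odd everywhere, hence linear: the faces have shrunk to one form e
    ([linear_limit_gauge]), which is extreme because a nested sequence of
    faces is a face ([extreme_limit_gauge]).  With y put in
    front of the sequence, e y = |y| ([norming_extreme_point]).

    Second, the extreme points are chosen greedily.  Put
    r_n = (u_0 + ... + u_(n-1)) - n f, take vectors z_k of rapidly decreasing
    norm that are multiples of the d_k, and let Q_n be the sum of r_n(z_k)^2
    over k < n.  Expanding the square, the cross term in Q_(n+1) - Q_n is twice
    (u_n - f)(y_n) with y_n the sum of r_n(z_k) z_k; choosing u_n to norm - y_n
    gives u_n y_n = - |y_n| <= f y_n, so this term is nonpositive.  The other
    terms are bounded, so Q_n = O(n) ([greedy_averages]), whence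
    r_n(z_k) / n -> 0 for each k.  The averages thus converge to f on a dense
    set, and being bounded they converge everywhere
    ([weak_star_cvg_dense]). *)

(** * Sublinear functionals dominated by the norm *)

Section Sublinear.
Context {R : realType} {E : normedModType R}.
Implicit Types (p : E -> R) (x y : E) (t : R).

(** Homogeneity is only required as an inequality, which is what passes to
    infima; equality follows ([sublinearZ]). *)
Definition norm_dominated_sublinear p :=
  [/\ forall x y, p (x + y) <= p x + p y,
      forall (t : R) x, 0 <= t -> p (t *: x) <= t * p x
    & forall x, p x <= `|x|].

Lemma sublinear0 p : norm_dominated_sublinear p -> p 0 = 0.
Proof.
move=> [pD pZ _]; apply/eqP; rewrite eq_le.
have := pZ 0 0 (lexx _); rewrite scale0r mul0r => -> /=.
by have := pD 0 0; rewrite addr0; lra.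
Qed.

Lemma sublinearZ p t x :
  norm_dominated_sublinear p -> 0 <= t -> p (t *: x) = t * p x.
Proof.
move=> ps; rewrite le_eqVlt => /predU1P[<-|t0].
  by rewrite scale0r mul0r sublinear0.
have [_ pZ _] := ps; apply/eqP; rewrite eq_le (pZ _ _ (ltW t0))/= -ler_pdivlMl//.
have /(pZ _ (t *: x)) : 0 <= t^-1 by rewrite invr_ge0 ltW.
by rewrite scalerA mulVf ?gt_eqF// scale1r.
Qed.

Lemma sublinear_geN p x : norm_dominated_sublinear p -> - `|x| <= p x.
Proof.
move=> ps; have [pD _ pn] := ps.
have := pD x (- x); rewrite subrr sublinear0//.
by have := pn (- x); rewrite normrN; lra.
Qed.

Lemma inf_image_le {I : Type} (D : set I) (h : I -> R) (b : R) (i : I) :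
  (forall j, D j -> b <= h j) -> D i -> inf (h @` D) <= h i.
Proof.
move=> hb Di; apply: ge_inf; last by exists i.
by exists b => _ [j Dj <-]; exact: hb.
Qed.

Lemma le_inf_image {I : Type} (D : set I) (h : I -> R) (b : R) :
  D !=set0 -> (forall j, D j -> b <= h j) -> b <= inf (h @` D).
Proof.
move=> [i Di] hb; apply: lb_le_inf; first by exists (h i), i.
by move=> _ [j Dj <-]; exact: hb.
Qed.

(** An infimum of functions is sublinear when the family is sublinear as a
    whole: the two inequalities may change the index.  This covers both the
    infimum over t >= 0 in [face_gauge], where indices add up and scale, and the
    limit of a decreasing sequence, where they are replaced by their maximum. *)
Lemma sublinear_inf {I : Type} (D : set I) (q : I -> E -> R) :
  D !=set0 ->
  (forall i x, D i -> - `|x| <= q i x) ->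
  (forall x, exists2 i, D i & q i x <= `|x|) ->
  (forall i j x y, D i -> D j -> exists2 k, D k & q k (x + y) <= q i x + q j y) ->
  (forall i t x, D i -> 0 <= t -> exists2 j, D j & q j (t *: x) <= t * q i x) ->
  norm_dominated_sublinear (fun x => inf [set q i x | i in D]).
Proof.
move=> D0 qlb qn qD qZ.
have infle x i : D i -> inf [set q i x | i in D] <= q i x.
  by apply: (@inf_image_le _ _ (q ^~ x) (- `|x|)) => j; exact: qlb.
split=> [x y|t x|x].
- rewrite -lerBlDr; apply: le_inf_image => // i Di.
  rewrite lerBlDr -lerBlDl; apply: le_inf_image => // j Dj.
  rewrite lerBlDl; have [k Dk] := qD i j x y Di Dj.
  exact/le_trans/infle.
- rewrite le_eqVlt => /predU1P[<-|t0].
    have [i Di] := D0; have [j Dj] := qZ i 0 x Di (lexx _).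
    by rewrite !mul0r; exact/le_trans/infle.
  rewrite -ler_pdivrMl//; apply: le_inf_image => // i Di.
  rewrite ler_pdivrMl//; have [j Dj] := qZ i t x Di (ltW t0).
  exact/le_trans/infle.
- by have [i Di] := qn x; exact/le_trans/infle.
Qed.

Lemma sublinear_norm : norm_dominated_sublinear (fun x => `|x|).
Proof.
by split=> // [x y|t x t0]; rewrite ?ler_normD// normrZ ger0_norm.
Qed.

(** * Gauges of faces *)

(** If p is the support function of a set K of linear forms, this is the
    support function of the face of K on which the evaluation at d attains its
    largest value p d.  It is the directional derivative of p at d in the
    direction x: substitute s = 1 / t in (p (d + s x) - p d) / s. *)
Definition face_gauge p d x : R :=
  inf [set p (x + t *: d) - t * p d | t in [set t : R | 0 <= t]].

Lemma face_gauge_lb p d x t : norm_dominated_sublinear p -> 0 <= t ->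
  - `|x| <= p (x + t *: d) - t * p d.
Proof.
move=> ps t0; have [pD _ pn] := ps.
have := pD (x + t *: d) (- x); rewrite addrAC subrr add0r sublinearZ//.
by have := pn (- x); rewrite normrN; lra.
Qed.

Lemma face_gauge_le p d x t : norm_dominated_sublinear p -> 0 <= t ->
  face_gauge p d x <= p (x + t *: d) - t * p d.
Proof.
move=> ps t0.
apply: (@inf_image_le _ _ (fun s => p (x + s *: d) - s * p d) (- `|x|)) => // s.
exact: face_gauge_lb.
Qed.

Lemma face_gauge_le_self p d x :
  norm_dominated_sublinear p -> face_gauge p d x <= p x.
Proof.
move=> ps; have := face_gauge_le p d x 0 ps (lexx _).
by rewrite scale0r addr0 mul0r subr0.
Qed.

(** On the face, the evaluation at d is constant, equal to p d: hence an upper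
    bound - p d for its values at - d. *)
Lemma face_gaugeN p d :
  norm_dominated_sublinear p -> face_gauge p d (- d) <= - p d.
Proof.
move=> ps; have := face_gauge_le p d (- d) 1 ps ler01.
by rewrite scale1r addNr mul1r sublinear0// sub0r.
Qed.

Lemma sublinear_face_gauge p d :
  norm_dominated_sublinear p -> norm_dominated_sublinear (face_gauge p d).
Proof.
move=> ps; have [pD pZ pn] := ps; apply: sublinear_inf => /=.
- by exists 0 => /=.
- by move=> t x; exact: face_gauge_lb.
- by move=> x; exists 0 => //; rewrite scale0r addr0 mul0r subr0.
- move=> s t x y s0 t0; exists (s + t); first exact: addr_ge0.
  have := pD (x + s *: d) (y + t *: d).
  by rewrite addrACA -scalerDl mulrDl; lra.
- move=> s t x s0 t0; exists (t * s); first exact: mulr_ge0.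
  by have := pZ t (x + s *: d) t0; rewrite scalerDr scalerA; nra.
Qed.

(** For linear g with g d = p d, each term of the infimum is at least
    g (x + t d) - t g d = g x. *)
Lemma le_face_gauge p d (g : {linear E -> R^o}) :
  (forall x, g x <= p x) -> g d = p d -> forall x, g x <= face_gauge p d x.
Proof.
move=> gp gd x; apply: le_inf_image; first by exists 0 => /=.
move=> t t0; have := gp (x + t *: d).
by rewrite linearD linearZ/= gd -lerBrDr.
Qed.

Fixpoint iter_gauge (d : nat -> E) (n : nat) : E -> R :=
  if n is m.+1 then face_gauge (iter_gauge d m) (d m) else fun x => `|x|.

Lemma sublinear_iter_gauge d n : norm_dominated_sublinear (iter_gauge d n).
Proof.
by elim: n => [|n ih] /=; [exact: sublinear_norm|exact: sublinear_face_gauge].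
Qed.

Lemma iter_gauge_nincr d x : nonincreasing_seq (fun n => iter_gauge d n x).
Proof.
apply/nonincreasing_seqP => n /=; apply: face_gauge_le_self.
exact: sublinear_iter_gauge.
Qed.

Definition limit_gauge (d : nat -> E) x : R :=
  inf [set iter_gauge d n x | n in [set: nat]].

Lemma limit_gauge_le d n x : limit_gauge d x <= iter_gauge d n x.
Proof.
apply: (@inf_image_le _ setT (fun n => iter_gauge d n x) (- `|x|)) => // m _.
exact/sublinear_geN/sublinear_iter_gauge.
Qed.

Lemma sublinear_limit_gauge d : norm_dominated_sublinear (limit_gauge d).
Proof.
apply: sublinear_inf.
- by exists 0%N.
- by move=> n x _; exact/sublinear_geN/sublinear_iter_gauge.
- by move=> x; exists 0%N.
- move=> m n x y _ _; exists (maxn m n) => //.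
  have [pD _ _] := sublinear_iter_gauge d (maxn m n).
  apply: le_trans (pD _ _) _.
  by apply: lerD; apply: iter_gauge_nincr; rewrite (leq_maxl, leq_maxr).
- move=> n t x _ t0; exists n => //.
  by have [_ pZ _] := sublinear_iter_gauge d n; exact: pZ.
Qed.

(** At step k the gauge becomes odd on d k; the limit inherits
    P (d k) + P (- d k) <= 0, and P x + P (- x) is at most 2 |x - d k| more. *)
Lemma limit_gaugeN d : dense (range d) ->
  forall x, limit_gauge d (- x) = - limit_gauge d x.
Proof.
move=> dd x; have Ps := sublinear_limit_gauge d; have [PD _ Pn] := Ps.
have odd_d k : limit_gauge d (d k) + limit_gauge d (- d k) <= 0.
  have := limit_gauge_le d k (d k); have := limit_gauge_le d k.+1 (- d k).
  by move=> /=; have := face_gaugeN _ (d k) (sublinear_iter_gauge d k); lra.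
apply/eqP; rewrite eq_le; apply/andP; split; last first.
  by have := PD x (- x); rewrite subrr sublinear0//; lra.
apply/ler_addgt0Pr => e e0; have e20 : 0 < e / 2 by rewrite divr_gt0.
have x_ball : ball x (e / 2) !=set0 by exists x; exact: ballxx.
have [z [xz [k _ dk]]] := dd _ x_ball (ball_open x (e / 2)).
move: xz; rewrite -dk -ball_normE /= => xy.
have := PD (x - d k) (d k); rewrite subrK.
have := PD (d k - x) (- d k); rewrite [d k - x]addrC addrK.
have := Pn (x - d k); have := Pn (- x + d k); rewrite addrC distrC.
rewrite [in d k + _]addrC; have := odd_d k.
by lra.
Qed.

(** An odd sublinear functional is linear; domination by the norm makes it a
    continuous form of norm at most 1. *)
Lemma linear_limit_gauge d : dense (range d) -> exists2 e : dual E,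
  (forall x, e x = limit_gauge d x) & `|e| <= 1.
Proof.
move=> dd; have Ps := sublinear_limit_gauge d; have [PD _ Pn] := Ps.
have PN := limit_gaugeN d dd.
have PL x y : limit_gauge d (x + y) = limit_gauge d x + limit_gauge d y.
  apply/eqP; rewrite eq_le PD/=.
  by have := PD (- x) (- y); rewrite -opprD !PN; lra.
have abs x : `|limit_gauge d x| <= `|x|.
  by rewrite ler_norml Pn andbT; exact: sublinear_geN.
have Pdual : (limit_gauge d : E -> R^o) \in @continuous_linear_form R E.
  apply/mem_set; split=> [a x y|x].
    rewrite PL; congr (_ + _); have [a0|a0] := leP 0 a; first exact: sublinearZ.
    by rewrite -[a]opprK scaleNr PN sublinearZ ?oppr_ge0 ?ltW// scaleNr.
  apply/cvgrPdist_lt => e e0; near=> y.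
  rewrite -PN -PL; apply: le_lt_trans (abs _) _.
  by near: y; exact: cvgr_dist_lt.
exists (Dual Pdual) => //; apply: dual_norm_le => x x1.
exact: le_trans (abs x) x1.
Unshelve. all: by end_near. Qed.

(** * Norming extreme points *)

Lemma dual_ball_le (g : dual E) x : dual_unit_ball E g -> g x <= `|x|.
Proof.
move=> g1; apply: le_trans (ler_norm _) _; apply: le_trans (ler_dual_norm g x) _.
exact: ler_piMl.
Qed.

(** If e lies strictly between g and h in the ball, then g and h stay in every
    face of the sequence: e attains the maximum at d n over the n-th face, so
    g and h attain it too.  In the limit g, h <= e, and linear forms
    comparable everywhere are equal. *)
Lemma extreme_limit_gauge d (e : dual E) :
  (forall x, e x = limit_gauge d x) -> `|e| <= 1 ->
  extreme_point (dual_unit_ball E) e.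
Proof.
move=> eP e1; split=> // g h t g1 h1 t0 t1 egh.
have ep n x : e x <= iter_gauge d n x by rewrite eP; exact: limit_gauge_le.
have ed n : e (d n) = iter_gauge d n (d n).
  apply/eqP; rewrite eq_le ep /=.
  have := face_gaugeN _ (d n) (sublinear_iter_gauge d n).
  by have := ep n.+1 (- d n); rewrite linearN /=; lra.
have eghE x : e x = t * g x + (1 - t) * h x by rewrite egh.
have gh_le n : (forall x, g x <= iter_gauge d n x) /\
               (forall x, h x <= iter_gauge d n x).
  elim: n => [|n [gn hn]] /=; first by split=> x; exact: dual_ball_le.
  have [gd hd] : g (d n) = iter_gauge d n (d n) /\ h (d n) = iter_gauge d n (d n).
    have := ed n; rewrite eghE; have := gn (d n); have := hn (d n).
    by move=> *; split; nra.
  by split; exact: le_face_gauge.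
have eqe (k : dual E) : (forall n x, k x <= iter_gauge d n x) -> k = e.
  move=> kp; have ke x : k x <= e x.
    by rewrite eP; apply: le_inf_image => //; exists 0%N.
  apply/val_inj/funext => x; apply/eqP; rewrite eq_le ke /=.
  by have := ke (- x); rewrite !linearN /=; lra.
by split; apply: eqe => n; case: (gh_le n).
Qed.

(** The first direction decides on which face of the ball the limit lies, so y
    is put in front of the dense sequence. *)
Lemma norming_extreme_point (d : nat -> E) : dense (range d) ->
  forall y : E, exists e : dual E,
    extreme_point (dual_unit_ball E) e /\ e y = `|y|.
Proof.
move=> dd y; pose d' k := if k is m.+1 then d m else y.
have dd' : dense (range d').
  move=> O O0 oO; have [z [Oz [k _ dk]]] := dd O O0 oO.
  by exists z; split=> //; exists k.+1.
have [e eP e1] := linear_limit_gauge d' dd'.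
exists e; split; first exact: extreme_limit_gauge eP e1.
apply/eqP; rewrite eq_le dual_ball_le//=.
have := limit_gauge_le d' 1%N (- y); rewrite -eP linearN /=.
by have := face_gaugeN _ y sublinear_norm; lra.
Qed.

End Sublinear.

(** * Greedy choice of the terms *)

Section GreedyAverages.
Context {R : realType} {E : normedModType R}.
Implicit Types (f g h : dual E) (x y : E).

Lemma dual_addE g h x : (g + h) x = g x + h x. Proof. by []. Qed.

Lemma dual_scaleE (a : R) g x : (a *: g) x = a * g x. Proof. by []. Qed.

Lemma dual_oppE g x : (- g) x = - g x. Proof. by []. Qed.

(** [ler_dual_norm] with the operator norm written as the norm of the normed
    space [dual E], which is the form in which norm lemmas apply to it. *)
Lemma ler_dual g x : `|g x| <= `|g| * `|x|. Proof. exact: ler_dual_norm. Qed.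

(** The partial sums are defined first, because the choice of the next term
    depends on the past only through them.  Here e y is meant to be an
    admissible form whose value at y is at most f y. *)
Fixpoint greedy_sum (f : dual E) (e : E -> dual E) (z : nat -> E) (n : nat) :
    dual E :=
  if n is m.+1 then
    let S := greedy_sum f e z m in
    S + e (\sum_(k < m) (S - m%:R *: f) (z k) *: z k)
  else 0.

Lemma half_pow_le1 (k : nat) : (2^-1 : R) ^+ k <= 1.
Proof. by rewrite exprn_ile1 ?invr_ge0 ?invf_le1 ?ler1n. Qed.

Lemma sum_half_pow_le2 (n : nat) : \sum_(k < n) (2^-1 : R) ^+ k <= 2.
Proof.
suff -> : \sum_(k < n) (2^-1 : R) ^+ k = 2 - 2 * 2^-1 ^+ n.
  by rewrite gerBl mulr_ge0// exprn_ge0 ?invr_ge0.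
elim: n => [|n ih]; first by rewrite big_ord0 expr0 mulr1 subrr.
by rewrite big_ord_recr /= ih exprS; field.
Qed.

Lemma half_pow_succn (n : nat) : n.+1%:R * (2^-1 : R) ^+ n <= 1.
Proof.
rewrite exprVn ler_pdivrMr ?exprn_gt0// mul1r -natrX ler_nat.
exact: ltn_expl.
Qed.

(** A greedy selection keeps the deviation r_n = S_n - n f of order sqrt n,
    measured by the values at the z k with k < n.  Restricting to k < n keeps
    the steering vector y_n a finite combination; the price is a new
    term r_(n+1)(z_n)^2 at each step, bounded because |z_n| decays
    geometrically while |r_(n+1)| grows linearly. *)
Lemma greedy_averages {A : set (dual E)} {f} {z : nat -> E} :
  A `<=` dual_unit_ball E -> dual_unit_ball E f ->
  (forall y, exists e : dual E, A e /\ e y <= f y) ->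
  (forall k, `|z k| <= 2^-1 ^+ k) ->
  exists u : nat -> dual E, (forall n, A (u n)) /\
    forall n, \sum_(k < n) (\sum_(i < n) u i - n%:R *: f) (z k) ^+ 2
              <= 12 * n%:R.
Proof.
move=> A1 f1 /choice[e eP] z1.
pose S := greedy_sum f e z; pose r n := S n - n%:R *: f.
pose y n := \sum_(k < n) r n (z k) *: z k.
exists (fun n => e (y n)); split=> [n|n]; first by have [] := eP (y n).
have -> : \sum_(i < n) e (y i) = S n.
  by elim: n => [|n ih]; rewrite ?big_ord0// big_ord_recr/= ih.
rewrite -/(r n); pose w n : dual E := e (y n) - f.
have rS m : r m.+1 = r m + w m.
  by rewrite /r /w /= -/S -/(r m) -/(y m) -natr1 scalerDl scale1r opprD addrACA.
have w2 m : `|w m| <= 2.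
  apply: le_trans (ler_normB _ _) _; rewrite -[2]/(1 + 1) lerD//.
  by apply: A1; have [] := eP (y m).
have r2 m : `|r m| <= 2 * m%:R.
  elim: m => [|m ih]; first by rewrite /r scale0r subr0 normr0 mulr0.
  rewrite rS -[m.+1%:R]natr1 mulrDr mulr1; apply: le_trans (ler_normD _ _) _.
  exact: lerD.
elim: n => [|n ih]; first by rewrite big_ord0 mulr0.
(* the increment is a cross term <= 0, the squares of the w n (z k), at most 8
   in total, and the new square, at most 4: whence the constant 12 *)
have wy : \sum_(k < n) r n (z k) * w n (z k) <= 0.
  have -> : \sum_(k < n) r n (z k) * w n (z k) = w n (y n).
    by rewrite linear_sum; apply: eq_bigr => k _; rewrite linearZ.
  by rewrite subr_le0; have [] := eP (y n).
have ww : \sum_(k < n) w n (z k) ^+ 2 <= 8.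
  suff : \sum_(k < n) w n (z k) ^+ 2 <= 4 * \sum_(k < n) 2^-1 ^+ k.
    by have := sum_half_pow_le2 n; lra.
  rewrite mulr_sumr; apply: ler_sum => k _.
  have wz : `|w n (z k)| <= 2 * 2^-1 ^+ k.
    by apply: le_trans (ler_dual _ _) _; rewrite ler_pM.
  have := half_pow_le1 k; rewrite -real_normK ?num_real//.
  by have := normr_ge0 (w n (z k)); nra.
have rz : r n.+1 (z n) ^+ 2 <= 4.
  have rz2 : `|r n.+1 (z n)| <= 2.
    apply: le_trans (ler_dual _ _) _.
    apply: le_trans (ler_pM _ _ (r2 n.+1) (z1 n)) _ => //.
    by have := half_pow_succn n; rewrite -mulrA; lra.
  rewrite -real_normK ?num_real//.
  by have := normr_ge0 (r n.+1 (z n)); nra.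
have -> : \sum_(k < n.+1) r n.+1 (z k) ^+ 2 =
  \sum_(k < n) r n (z k) ^+ 2 + 2 * \sum_(k < n) r n (z k) * w n (z k)
  + \sum_(k < n) w n (z k) ^+ 2 + r n.+1 (z n) ^+ 2.
  rewrite big_ord_recr mulr_sumr -!big_split; congr (_ + _).
  by apply: eq_bigr => k _; rewrite rS dual_addE sqrrD mulr_natl.
by rewrite -[n.+1%:R]natr1; lra.
Qed.

(** * Weak* convergence *)

(** The forms g n - f are equicontinuous, being bounded in norm, so their
    values at x are controlled by those at a nearby d k. *)
Lemma weak_star_cvg_dense (g : nat -> dual E) f (M : R) (d : nat -> E) :
  dense (range d) -> (forall n, `|g n - f| <= M) ->
  (forall k, g n (d k) @[n --> \oo] --> f (d k)) ->
  (g : nat -> weak_star E) @ \oo --> (f : weak_star E).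
Proof.
move=> dd gM gd; apply/weak_star_cvgP => x.
have M0 : 0 <= M by apply: le_trans (gM 0%N).
(* the radius has M + 1 in the denominator because M may be 0 *)
apply/cvgrPdist_lt => e e0; pose rho := e / 2 / (M + 1).
have rho0 : 0 < rho by rewrite !divr_gt0// ltr_wpDl.
have x_ball : ball x rho !=set0 by exists x; exact: ballxx.
have [z [xz [k _ dk]]] := dd _ x_ball (ball_open x rho).
move: xz; rewrite -dk -ball_normE /= => xz.
have e20 : 0 < e / 2 by rewrite divr_gt0.
have /cvgrPdist_lt /(_ _ e20) := gd k.
apply: filterS => n; rewrite distrC => gnk /=; rewrite distrC.
have gnx : `|(g n - f) (x - d k)| <= M * rho.
  apply: le_trans (ler_dual _ _) _.
  by apply: ler_pM => //; exact: ltW.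
have Mrho : M * rho <= e / 2.
  rewrite /rho mulrCA ler_piMr ?(ltW e20)// ler_pdivrMr ?ltr_wpDl// mul1r.
  by rewrite lerDl.
have -> : g n x - f x = (g n - f) (x - d k) + (g n (d k) - f (d k)).
  by rewrite dual_addE dual_oppE !linearB/=; ring.
apply: le_lt_trans (ler_normD _ _) _; rewrite [e]splitr.
by apply: ler_ltD => //; exact: le_trans gnx Mrho.
Qed.

End GreedyAverages.

Lemma separable_dense_seq {R : realType} {E : normedModType R} :
  separable E -> exists d : nat -> E, dense (range d).
Proof.
move=> [D /pfcard_geP[D0|[s]] dD].
  by have [|x []] := dD setT _ openT; [exists 0|rewrite D0].
exists s => O O0 oO; have [x [Ox Dx]] := dD O O0 oO.
have [n _ sn] := @surj _ _ _ _ s x Dx.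
by exists x; split=> //; exists n.
Qed.

(** A single square is at most the whole sum, so (r_n(z k) / n)^2 <= C / n as
    soon as n > k. *)
Lemma cvg_average_at {R : realType} {E : normedModType R}
    {u : nat -> dual E} {f : dual E} {C : R} {z : nat -> E} :
  (forall n, \sum_(k < n) (\sum_(i < n) u i - n%:R *: f) (z k) ^+ 2
             <= C * n%:R) ->
  forall k, (n%:R^-1 *: \sum_(i < n) u i) (z k) @[n --> \oo] --> f (z k).
Proof.
move=> uC k; apply/cvgrPdist_lt => e e0.
have := nbhs_infty_gtr (C / e ^+ 2); have := nbhs_infty_gt k.
apply: filterS2 => n kn; rewrite ltr_pdivrMr ?exprn_gt0// => Cn.
have n0 : 0 < n%:R :> R by rewrite ltr0n (leq_trans _ kn).
set S := \sum_(i < n) u i.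
have -> : f (z k) - (n%:R^-1 *: S) (z k)
        = - (n%:R^-1 * (S - n%:R *: f) (z k)).
  by rewrite !dual_addE dual_oppE !dual_scaleE; field; rewrite gt_eqF.
rewrite normrN normrM gtr0_norm ?invr_gt0// ltr_pdivrMl//.
have : (S - n%:R *: f) (z k) ^+ 2 <= C * n%:R.
  apply: le_trans (uC n); rewrite (bigD1 (Ordinal kn))//= lerDl.
  by apply: sumr_ge0 => i _; exact: sqr_ge0.
move=> SC; rewrite -(@ltr_pXn2r _ 2) ?nnegrE ?normr_ge0 ?mulr_ge0 ?ltW//.
rewrite real_normK ?num_real//; apply: le_lt_trans SC _.
have -> : (n%:R * e) ^+ 2 = n%:R * e ^+ 2 * n%:R by ring.
by rewrite ltr_pM2r.
Qed.

Theorem corollary3 (R : realType) (E : completeNormedModType R)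
    (sepE : separable E) (f : dual E) (f_ball : dual_unit_ball E f) :
  exists u : nat -> dual E,
    (forall n, extreme_point (dual_unit_ball E) (u n)) /\
    ((fun N : nat => N%:R^-1 *: \sum_(n < N) u n) : nat -> weak_star E) @ \oo
      --> (f : weak_star E).
Proof.
have [d dd] := separable_dense_seq sepE.
(* the factor 1 / (1 + |d k|) brings d k into the unit ball even if d k = 0,
   and c k <> 0 lets convergence at z k be carried back to d k *)
pose c k : R := 2^-1 ^+ k / (1 + `|d k|).
have c0 k : 0 < c k by rewrite divr_gt0 ?exprn_gt0 ?invr_gt0 ?ltr_wpDr.
pose z k := c k *: d k; have z1 k : `|z k| <= 2^-1 ^+ k.
  rewrite normrZ gtr0_norm// /c -mulrA ler_piMr ?exprn_ge0 ?invr_ge0//.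
  by rewrite mulrC ler_pdivrMr ?ltr_wpDr// mul1r lerDr.
have support y : exists e : dual E,
    extreme_point (dual_unit_ball E) e /\ e y <= f y.
  have [e [ext_e ey]] := norming_extreme_point d dd (- y); exists e; split=> //.
  have := dual_ball_le f (- y) f_ball.
  by rewrite -ey !linearN /= lerN2.
have ext1 : extreme_point (dual_unit_ball E) `<=` dual_unit_ball E.
  by move=> g [].
have [u [u_ext uC]] := greedy_averages ext1 f_ball support z1.
exists u; split=> //; apply: (@weak_star_cvg_dense _ _ _ _ 2 d dd) => [n|k].
  have u1 : `|\sum_(i < n) u i| <= n%:R.
    apply: le_trans (ler_norm_sum _ _ _) _.
    rewrite -[n in n%:R]card_ord -sumr_const; apply: ler_sum => i _.
    exact/ext1.
  apply: le_trans (ler_normB _ _) _; rewrite -[2]/(1 + 1) lerD//.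
  rewrite normrZ normfV normr_nat; have [->|n0] := posnP n.
    by rewrite invr0 mul0r.
  by rewrite ler_pdivrMl ?ltr0n// mulr1.
have rescale (g : dual E) : g (d k) = (c k)^-1 * g (z k).
  by rewrite /z linearZ/= mulrA mulVf ?mul1r// gt_eqF.
rewrite rescale; under eq_fun do rewrite rescale.
by apply: cvgMl_tmp; exact: cvg_average_at uC k.
Qed.
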